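(* Suppose $\mu$ is such that $A=0$ and $B=\infty$. Let $\rho\in[0,1)$ be fixed and consider the sequence of symmetric $n\times n$ margins $(\mathbf r_n,\mathbf r_n)$ with $$\mathbf r_n=(\underbrace{t_nn,\ldots,t_nn}_{\lfloor n^\rho\rfloor},\underbrace{s_nn,\ldots,s_nn}_{n-\lfloor n^\rho\rfloor})\in\mathbb R^n,$$ where $s_n,t_n\in(0,\infty)$, $s_n\to s$ and $t_n\to t$ as $n\to\infty$, with $0<s\le t<\infty$. If $2\phi(t)-\phi(s)<\phi(B)$, then there is $\delta>0$ such that $(\mathbf r_n,\mathbf r_n)$ is $\delta$-tame for all $n\ge1$. If $2\phi(t)-\phi(s)>\phi(B)$, then the $(1,1)$ entry of the typical table for $(\mathbf r_n,\mathbf r_n)$ diverges to infinity as $n\to\infty$.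
   Context: Let $\mu$ be a $\sigma$-finite Borel measure on $\mathbb R$, $A=\inf\operatorname{supp}\mu$, $B=\sup\operatorname{supp}\mu$. Let $\Theta=\{\theta\in\mathbb R:\int e^{\theta x}\mu(dx)<\infty\}$, assumed nonempty and not a singleton, with interior $\Theta^\circ$; $\psi(\theta)=\log\int e^{\theta x}\mu(dx)$. Standing assumption: $\psi''>0$ on $\Theta^\circ$ and $\psi':\Theta^\circ\to(A,B)$ is a bijection with inverse $\phi$; write $\phi(B)=\sup\Theta\in(-\infty,\infty]$. An $m\times n$ margin is a pair $(\mathbf r,\mathbf c)\in\mathbb R^m\times\mathbb R^n$. An MLE for it is a maximizer of $\langle\mathbf r,\boldsymbol\alpha\rangle+\langle\mathbf c,\boldsymbol\beta\rangle-\sum_{i,j}\psi(\boldsymbol\alpha(i)+\boldsymbol\beta(j))$ over $(\boldsymbol\alpha,\boldsymbol\beta)$ with all $\boldsymbol\alpha(i)+\boldsymbol\beta(j)\in\Theta^\circ$. The typical table is the unique minimizer of $\sum_{i,j}[z_{ij}\phi(z_{ij})-\psi(\phi(z_{ij}))]$ over $Z=(z_{ij})\in(A,B)^{m\times n}$ with row sums $\mathbf r$ and column sums $\mathbf c$; when an MLE $(\boldsymbol\alpha,\boldsymbol\beta)$ exists its entries are $\psi'(\boldsymbol\alpha(i)+\boldsymbol\beta(j))$. For $\delta>0$, $A_\delta=\max(A+\delta,-1/\delta)$, $B_\delta=\min(B-\delta,1/\delta)$; $(\mathbf r,\mathbf c)$ is $\delta$-tame if an MLE exists and $A_\delta\le\psi'(\boldsymbol\alpha(i)+\boldsymbol\beta(j))\le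 B_\delta$ for all $i,j$. *)

(* Defs.v *)
From HB Require Import structures.
From mathcomp Require Export all_boot all_order all_algebra.
From mathcomp Require Export all_classical all_reals all_analysis.
Export Order.TTheory GRing.Theory Num.Theory.
Export numFieldNormedType.Exports.

#[export] Set Implicit Arguments.
#[export] Unset Strict Implicit.
#[export] Unset Printing Implicit Defensive.

Local Open Scope classical_set_scope.
Local Open Scope ring_scope.

Notation borel_measure R :=
  {sigma_finite_measure set (measurableTypeR R) -> \bar R}.

Section ExponentialTilting.
Context {R : realType} (mu : borel_measure R).

(* Open neighbourhoods, rather than [nbhs x], so that [mu] is only ever applied
   to Borel sets. *)
Definition supp : set R :=
  [set x | forall U : set R, open U -> U x -> (0 < mu U)%E].

Definition infsupp : \bar R := ereal_inf (EFin @` supp).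
Definition supsupp : \bar R := ereal_sup (EFin @` supp).

Definition laplace (theta : R) : \bar R :=
  (\int[mu]_x (expR (theta * x))%:E)%E.

Definition Theta : set R := [set theta | (laplace theta < +oo)%E].

(* Only meaningful on [Theta]: [fine] sends +oo to 0. *)
Definition psi (theta : R) : R := ln (fine (laplace theta)).

Definition dpsi : R -> R := derive1 psi.

Definition AB : set R := [set x | (infsupp < x%:E < supsupp)%E].

(* [pinv D f] is the inverse of [f] restricted to [D]; it takes a default
   value off the image [f @` D]. *)
Definition phi : R -> R := pinv (interior Theta) dpsi.

(* The value written phi(B). *)
Definition phiB : \bar R := ereal_sup (EFin @` Theta).

Definition standing : Prop :=
  [/\ Theta !=set0, (forall theta : R, Theta <> [set theta]),
      (forall theta, interior Theta theta -> 0 < derive1 dpsi theta) &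
      set_bij (interior Theta) AB dpsi].

Section Margins.
Context {m n : nat} (r : 'rV[R]_m) (c : 'rV[R]_n).

Definition mle_admissible (a : 'rV[R]_m) (b : 'rV[R]_n) : Prop :=
  forall i j, interior Theta (a 0 i + b 0 j).

Definition log_likelihood (a : 'rV[R]_m) (b : 'rV[R]_n) : R :=
  \sum_i r 0 i * a 0 i + \sum_j c 0 j * b 0 j
  - \sum_i \sum_j psi (a 0 i + b 0 j).

Definition is_mle (a : 'rV[R]_m) (b : 'rV[R]_n) : Prop :=
  mle_admissible a b /\
  forall a' b', mle_admissible a' b' ->
    log_likelihood a' b' <= log_likelihood a b.

Definition transport_polytope : set 'M[R]_(m, n) :=
  [set Z | [/\ forall i j, AB (Z i j),
               forall i, \sum_j Z i j = r 0 i &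
               forall j, \sum_i Z i j = c 0 j]].

Definition table_cost (Z : 'M[R]_(m, n)) : R :=
  \sum_i \sum_j (Z i j * phi (Z i j) - psi (phi (Z i j))).

Definition table_minimizer (Z : 'M[R]_(m, n)) : Prop :=
  transport_polytope Z /\
  forall W, transport_polytope W -> table_cost Z <= table_cost W.

Definition is_typical_table (Z : 'M[R]_(m, n)) : Prop :=
  table_minimizer Z /\ forall W, table_minimizer W -> W = Z.

Definition Adelta (delta : R) : \bar R :=
  maxe (infsupp + delta%:E)%E (- delta^-1)%:E.

Definition Bdelta (delta : R) : \bar R :=
  mine (supsupp - delta%:E)%E (delta^-1)%:E.

(* MLEs are unique only up to a shift (a + x, b - x), which leaves all the sums
   [a 0 i + b 0 j] unchanged; hence the existential. *)
Definition tame (delta : R) : Prop :=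
  exists a b, is_mle a b /\
    forall i j, (Adelta delta <= (dpsi (a 0 i + b 0 j))%:E <= Bdelta delta)%E.

End Margins.
End ExponentialTilting.

Definition two_value_margin {R : realType} (rho : R) (s t : nat -> R) (n : nat)
    : 'rV[R]_n :=
  \row_(i < n) ((if (i < Num.truncn (n%:R `^ rho))%N then t n else s n) * n%:R).

(* Main.v *)
(* Since supp mu is contained in [0, +oo), Theta is a down-set with interior
   (-oo, phi(B)). A pair (alpha, beta) for which the table psi'(alpha_i + beta_j)
   has the prescribed margins is an MLE, and that table is the unique typical
   table: both follow from the strict tangent inequality
   psi'(x) y - psi(y) < psi'(x) x - psi(x) for y <> x, summed over the entries.

   For two-valued margins with k = floor(n^rho) large entries and l = n - k, such
   a table has three values p, q, w with k p + l q = n t_n, k q + l w = n s_n and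
   phi(p) + phi(w) = 2 phi(q). Eliminating p and w leaves one equation for q,
   solved by the intermediate value theorem on (0, min(n t_n / l, n s_n / k))
   because phi tends to -oo at 0. Hence an MLE exists for every n.

   As k / l -> 0, w -> s, and q -> t as long as p stays bounded, in which case
   phi(p) = 2 phi(q) - phi(w) -> 2 phi(t) - phi(s). As phi(p) < phi(B) always, p is
   unbounded when this limit exceeds phi(B). Conversely q <= n t_n / l gives the
   upper bound limsup phi(p) <= 2 phi(t) - phi(s) without assuming p bounded, so p
   is bounded when the limit is below phi(B). *)
Require Import Defs.
From mathcomp Require Import measurable_realfun lra ring.
Local Open Scope classical_set_scope.
Local Open Scope ring_scope.

(** * The interior of Theta *)

Section Laplace.
Context {R : realType} (mu : borel_measure R).

(** Second countability: each point outside the support lies in a null interval with rational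
    endpoints, and there are countably many of these. *)
Lemma negligible_setC_supp : mu.-negligible (~` supp mu).
Proof.
pose J (q : rat * rat) : set R := `](ratr q.1), (ratr q.2)[%classic.
pose F k : set R := if (unpickle k : option (rat * rat)) is Some q
  then (if `[< mu (J q) = 0%E >] then J q else set0) else set0.
apply: (@negligibleS _ _ _ mu (\bigcup_k F k)); last first.
  apply: negligible_bigcup => k; rewrite /F.
  case: (unpickle k) => [q|]; last exact: negligible_set0.
  case: asboolP => [q0|_]; last exact: negligible_set0.
  by exists (J q); split => //; exact: measurable_itv.
move=> x /existsNP[U] /not_implyP[oU] /not_implyP[Ux] /negP; rewrite -leNgt => U0.
have [e /= e0 eU] := (nbhs_ballP x U).1 (open_nbhs_nbhs (conj oU Ux)).
have xe : x - e < x by rewrite ltrBlDr ltrDl.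
have ex : x < x + e by rewrite ltrDl.
have [p] := rat_in_itvoo xe; have [q] := rat_in_itvoo ex.
rewrite !in_itv/= => /andP[xq qe] /andP[ep px].
have pq0 : mu (J (p, q)) = 0%E.
  apply/eqP; rewrite -measure_le0; apply: le_trans U0.
  apply: le_measure; rewrite ?inE; [exact: measurable_itv|exact: open_measurable|].
  move=> y; rewrite /J/= in_itv/= => /andP[py yq]; apply: eU.
  rewrite /ball/= ltr_distlC; apply/andP; split; lra.
exists (pickle (p, q)); first exact: I.
rewrite /F pickleK; case: asboolP => [_|/(_ pq0)[]].
by rewrite /J/= in_itv/= px xq.
Qed.

Lemma ae_infsupp_le : {ae mu, forall x, (infsupp mu <= x%:E)%E}.
Proof.
apply: negligibleS negligible_setC_supp => x/= + sx; apply.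
by apply: ereal_inf_lbound; exists x.
Qed.

Lemma measurable_expRM (theta : R) :
  measurable_fun [set: measurableTypeR R] (fun x => (expR (theta * x))%:E).
Proof.
by apply/measurable_EFinP; apply: measurableT_comp.
Qed.

Hypothesis hA : (0 <= infsupp mu)%E.

(** The integrand increases with the parameter only at points z >= 0, and these have full measure
    because A >= 0. *)
Lemma le_laplace (x y : R) : x <= y -> (laplace mu x <= laplace mu y)%E.
Proof.
move=> xy; apply: ae_ge0_le_integral => //.
- exact: measurable_expRM.
- exact: measurable_expRM.
apply: (@filterS _ _ (ae_filter_ringOfSetsType mu) _ _ _ ae_infsupp_le).
move=> z /(le_trans hA); rewrite lee_fin => z0 _.
by rewrite lee_fin ler_expR ler_wpM2r.
Qed.

Lemma ThetaW (x y : R) : x <= y -> Theta mu y -> Theta mu x.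
Proof. by move=> /le_laplace; exact: le_lt_trans. Qed.

(** [Theta] is a ray unbounded below; its supremum is never interior, even when it belongs to
    [Theta]. *)
Lemma interior_ThetaP (x : R) : interior (Theta mu) x <-> (x%:E < phiB mu)%E.
Proof.
split=> [/nbhs_ballP[e /= e0 eT]|/ereal_sup_gt[_ [y Ty <-]]].
  apply: (@lt_le_trans _ _ (x + e / 2)%:E); first by rewrite lte_fin; lra.
  apply: ereal_sup_ubound; exists (x + e / 2) => //; apply: eT.
  by rewrite /ball/= ltr_distlC; apply/andP; split; lra.
rewrite lte_fin => xy; near=> z; apply: ThetaW Ty.
by near: z; exact: lt_le_nbhsl.
Unshelve. all: by end_near. Qed.

End Laplace.

(** * Cumulant functions on a down-set *)

(* The properties of psi, psi' and phi = (psi')^-1 used in the proof, with [D]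
   playing the role of the interior of Theta. *)
Record cumulant {R : realType} (D : set R) (f df g : R -> R) : Prop := Cumulant {
  cumulant_open : open D;
  cumulant_down : forall x y : R, x <= y -> D y -> D x;
  cumulant_derive : forall x : R, D x -> is_derive x 1 f (df x);
  cumulant_derivable : forall x : R, D x -> derivable df x 1;
  cumulant_convex : forall x : R, D x -> 0 < derive1 df x;
  cumulant_gt0 : forall x : R, D x -> 0 < df x;
  cumulant_inv_dom : forall z : R, 0 < z -> D (g z);
  cumulant_invK : forall z : R, 0 < z -> df (g z) = z;
  cumulant_derivK : forall x : R, D x -> g (df x) = x
}.

Section Cumulant.
Context {R : realType} (D : set R) (f df g : R -> R).
Hypothesis cfg : cumulant D f df g.

Let domW (x y : R) : x <= y -> D y -> D x.
Proof. by move=> xy; apply: (cumulant_down cfg). Qed.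

Let gD (z : R) : 0 < z -> D (g z).
Proof. by move=> z0; apply: (cumulant_inv_dom cfg). Qed.

Lemma derivable_within_dom (h : R -> R) (a b : R) :
  (forall x, D x -> derivable h x 1) -> D b -> {within `[a, b], continuous h}.
Proof.
move=> dh Db; apply: derivable_within_continuous => x.
by rewrite in_itv/= => /andP[_ xb]; apply: dh; exact: domW Db.
Qed.

Lemma deriv_lt (x y : R) : D y -> x < y -> df x < df y.
Proof.
move=> Dy xy; have Dz z : z \in `]x, y[ -> D z.
  by rewrite in_itv/= => /andP[_ /ltW zy]; exact: domW Dy.
apply: (@gtr0_derive1_lt_cc _ _ x y) => //.
- by move=> z /Dz; exact: cumulant_derivable cfg _.
- by move=> z /Dz; exact: cumulant_convex cfg _.
- exact: derivable_within_dom (cumulant_derivable cfg) Dy.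
- by rewrite in_itv/= lexx ltW.
- by rewrite in_itv/= lexx ltW.
Qed.

Lemma deriv_le (x y : R) : D y -> x <= y -> df x <= df y.
Proof.
by move=> Dy; rewrite le_eqVlt => /predU1P[->//|/(deriv_lt Dy)/ltW].
Qed.

Lemma chord_lt (x y : R) : D y -> x < y ->
  df x * (y - x) < f y - f x < df y * (y - x).
Proof.
move=> Dy xy; have Dz z : z < y -> D z by move=> /ltW zy; exact: domW Dy.
have df' := cumulant_derive cfg.
have [z||z] := @MVT _ f df x y xy.
- by rewrite in_itv/= => /andP[_ /Dz]; exact: df'.
- apply: derivable_within_dom Dy => z Dfz.
  exact: (@ex_derive _ _ _ _ _ _ _ (df' _ Dfz)).
- rewrite in_itv/= => /andP[xz zy] ->; have xy0 : 0 < y - x by rewrite subr_gt0.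
  by rewrite !(ltr_pM2r xy0) !deriv_lt//; exact: Dz.
Qed.

(* Strict Fenchel-Young: y |-> f'(x) y - f(y) is maximal at y = x only. *)
Lemma tangent_lt (x y : R) : D x -> D y -> x != y ->
  df x * y - f y < df x * x - f x.
Proof.
move=> Dx Dy; rewrite neq_lt => /orP[xy|yx].
- by have /andP[+ _] := chord_lt Dy xy; lra.
- by have /andP[_] := chord_lt Dx yx; lra.
Qed.

Lemma tangent_le (x y : R) : D x -> D y -> df x * y - f y <= df x * x - f x.
Proof. by have [->//|xy Dx Dy] := eqVneq x y; apply/ltW/tangent_lt. Qed.

Lemma inv_lt (x y : R) : 0 < x -> x < y -> g x < g y.
Proof.
move=> x0 xy; have y0 := lt_trans x0 xy; rewrite ltNge; apply/negP.
by move=> /(deriv_le (gD x0)); rewrite !(cumulant_invK cfg)// leNgt xy.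
Qed.

Lemma inv_le (x y : R) : 0 < x -> x <= y -> g x <= g y.
Proof.
by move=> x0; rewrite le_eqVlt => /predU1P[->//|/(inv_lt x0)/ltW].
Qed.

Lemma le_inv (x z : R) : 0 < z -> D x -> g z <= x -> z <= df x.
Proof. by move=> z0 Dx /(deriv_le Dx); rewrite (cumulant_invK cfg). Qed.

Lemma ge_inv (x z : R) : 0 < z -> x <= g z -> df x <= z.
Proof. by move=> z0 /(deriv_le (gD z0)); rewrite (cumulant_invK cfg). Qed.

Lemma inv_continuous (z : R) : 0 < z -> {for z, continuous g}.
Proof.
move=> z0; suff: {near z, continuous g} by move/nbhs_singleton.
rewrite -{1}(cumulant_invK cfg z0).
have nD : \forall x \near g z, D x.
  by apply: open_nbhs_nbhs; split; [case: cfg|exact: gD].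
apply: near_can_continuous; apply: filterS nD => x Dx.
  exact: (cumulant_derivK cfg Dx).
apply/differentiable_continuous/derivable1_diffP.
exact: (cumulant_derivable cfg Dx).
Qed.

(** This is the limit of [g] at 0 being -oo. A point of [D] below c exists since [D] is a down-set;
    its derivative is positive and serves as e. *)
Lemma inv_le_near0 (c : R) : exists2 e, 0 < e & forall z, 0 < z <= e -> g z <= c.
Proof.
have Dm : D (Num.min c (g 1)).
  by apply: domW (gD ltr01); rewrite ge_min lexx orbT.
exists (df (Num.min c (g 1))); first exact: (cumulant_gt0 cfg Dm).
move=> z /andP[z0 /(inv_le z0)]; rewrite (cumulant_derivK cfg)// => /le_trans.
by apply; rewrite ge_min lexx.
Qed.

(** The hypothesis makes p the value that vanishes at q = T / l, while w > 0 for all smaller q. So g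
    p + g w - 2 g q is positive for q near 0, where g q tends to -oo, and negative for q near T / l,
    where g p does. *)
Lemma balanced_values_half (k l T S : R) : 0 < k -> 0 < l -> 0 < T ->
  T / l <= S / k ->
  exists p q w, [/\ 0 < p, 0 < q & 0 < w] /\
    [/\ k * p + l * q = T, k * q + l * w = S & g p + g w = 2 * g q].
Proof.
move=> k0 l0 T0; set Q := T / l => QS.
have Q0 : 0 < Q by rewrite divr_gt0.
have TE : T = l * Q by rewrite mulrC divfK// gt_eqF.
have kQ : k * Q <= S by rewrite mulrC -ler_pdivlMr.
pose P q := (T - l * q) / k; pose W q := (S - k * q) / l.
have P0 q : q < Q -> 0 < P q.
  by move=> qQ; rewrite divr_gt0// TE -mulrBr mulr_gt0// subr_gt0.
have W0 q : q < Q -> 0 < W q.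
  by move=> qQ; rewrite divr_gt0// subr_gt0 (lt_le_trans _ kQ)// ltr_pM2l.
have Ple q q' : q <= q' -> P q' <= P q.
  by move=> qq; rewrite ler_pM2r ?invr_gt0// lerB// ler_pM2l.
have Wle q q' : q <= q' -> W q' <= W q.
  by move=> qq; rewrite ler_pM2r ?invr_gt0// lerB// ler_pM2l.
have hQ : 0 < Q / 2 < Q by lra.
case/andP: hQ => hQ0 hQQ.
(* [P] and [W] decrease, so their values at Q / 2 bound them below to the left of Q / 2, and [W 0]
   bounds [W] above. *)
have [e1 e10 he1] := inv_le_near0 ((g (P (Q / 2)) + g (W (Q / 2))) / 2).
have [e2 e20 he2] := inv_le_near0 (2 * g (Q / 2) - g (W 0)).
(* Since P q = (Q - q) l / k, the shift by e2 k / l is what makes P q2 <= e2. *)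
pose q1 := Num.min e1 (Q / 2); pose q2 := Num.max (Q / 2) (Q - e2 * (k / l)).
have q10 : 0 < q1 by rewrite lt_min e10.
have q1Q : q1 <= Q / 2 by rewrite ge_min lexx orbT.
have q2Q : Q / 2 <= q2 by rewrite le_max lexx.
have q2lt : q2 < Q by rewrite gt_max hQQ/= ltrBlDr ltrDl mulr_gt0// divr_gt0.
pose G q := g (P q) + g (W q) - 2 * g q.
have q12 : q1 <= q2 := le_trans q1Q q2Q.
have G1 : 0 <= G q1.
  have := he1 q1; rewrite q10 ge_min lexx => /(_ isT).
  have := inv_le (P0 _ hQQ) (Ple _ _ q1Q).
  have := inv_le (W0 _ hQQ) (Wle _ _ q1Q).
  by rewrite /G; lra.
have G2 : G q2 <= 0.
  have Pe : P q2 <= e2.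
    have : Q - e2 * (k / l) <= q2 by rewrite le_max lexx orbT.
    rewrite /P TE -mulrBr ler_pdivrMr// lerBlDr -lerBlDl => h.
    by rewrite mulrC -ler_pdivlMr// -mulrA.
  have := he2 (P q2); rewrite P0// => /(_ Pe).
  have := inv_le (W0 _ q2lt) (Wle _ _ (le_trans (ltW hQ0) q2Q)).
  have := inv_le hQ0 q2Q.
  by rewrite /G; lra.
have [||q] := @IVT _ G q1 q2 0 q12.
- apply: continuous_in_subspaceT => q; rewrite inE/= in_itv/= => /andP[qq1 qq2].
  have q0 := lt_le_trans q10 qq1; have qQ := le_lt_trans qq2 q2lt.
  have cP : {for q, continuous P}.
    by apply: cvgMr_tmp; apply: cvgB; [exact: cvg_cst|apply: cvgMl_tmp; exact: cvg_id].
  have cW : {for q, continuous W}.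
    by apply: cvgMr_tmp; apply: cvgB; [exact: cvg_cst|apply: cvgMl_tmp; exact: cvg_id].
  apply: cvgB; last by apply: cvgMl_tmp; exact: inv_continuous.
  apply: cvgD.
    by apply: (@continuous_comp _ _ _ P g) => //; apply: inv_continuous; exact: P0.
  by apply: (@continuous_comp _ _ _ W g) => //; apply: inv_continuous; exact: W0.
- by rewrite ge_min le_max G1 G2 orbT.
rewrite in_itv/= => /andP[qq1 qq2] Gq.
have q0 := lt_le_trans q10 qq1; have qQ := le_lt_trans qq2 q2lt.
exists (P q), q, (W q); split; split => //; [exact: P0|exact: W0|..].
- by rewrite /P mulrC divfK ?gt_eqF// subrK.
- by rewrite /W addrC mulrC divfK ?gt_eqF// subrK.
- by apply/eqP; rewrite -subr_eq0; apply/eqP.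
Qed.

(** The system is invariant under exchanging (k, T, p) with (l, S, w), which reduces the other order
    of T / l and S / k to the previous case. *)
Lemma balanced_values (k l T S : R) : 0 < k -> 0 < l -> 0 < T -> 0 < S ->
  exists p q w, [/\ 0 < p, 0 < q & 0 < w] /\
    [/\ k * p + l * q = T, k * q + l * w = S & g p + g w = 2 * g q].
Proof.
move=> k0 l0 T0 S0; have [TS|/ltW ST] := leP (T / l) (S / k).
  exact: balanced_values_half.
have [p [q [w [[p0 q0 w0] [e1 e2 e3]]]]] := balanced_values_half l0 k0 S0 ST.
exists w, q, p; do 2!split => //; first by rewrite addrC.
  by rewrite addrC.
by rewrite addrC.
Qed.

End Cumulant.

(** * Balanced values when the large block is negligible *)

Section Asymptotics.
Context {R : realType} (D : set R) (f df g : R -> R).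
Hypothesis cfg : cumulant D f df g.
Context (la ka s_ t_ : nat -> R) (s t : R).
Hypotheses (la1 : la @ \oo --> (1 : R)) (ka0 : ka @ \oo --> (0 : R)).
Hypothesis ka_ge0 : forall n, 0 <= ka n.
Hypotheses (hs : s_ @ \oo --> s) (ht : t_ @ \oo --> t) (s0 : 0 < s) (t0 : 0 < t).

(** The row equations k p + l q = n t_n and k q + l w = n s_n divided by l, with [la] and [ka]
    standing for n / l and k / l. *)
Definition balanced (n : nat) (p q w : R) : Prop :=
  [/\ 0 < p, 0 < q & 0 < w] /\
  [/\ q = la n * t_ n - ka n * p, w = la n * s_ n - ka n * q &
      g p + g w = 2 * g q].

Let cvg_la (u : nat -> R) (x : R) :
  u @ \oo --> x -> (fun n => la n * u n) @ \oo --> x.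
Proof. by move=> ux; rewrite -[x]mul1r; apply: cvgM. Qed.

Let cvg_laka (u v : nat -> R) (x y : R) : u @ \oo --> x -> v @ \oo --> y ->
  (fun n => la n * u n - ka n * v n) @ \oo --> x.
Proof.
move=> ux vy; rewrite -[x]subr0 -(mul0r y); apply: cvgB; first exact: cvg_la.
exact: cvgM.
Qed.

Let cvg_potential (u v : nat -> R) : u @ \oo --> t -> v @ \oo --> s ->
  (fun n => 2 * g (u n) - g (v n)) @ \oo --> 2 * g t - g s.
Proof.
move=> ut vs; apply: cvgB.
  apply: cvgMl_tmp; apply: continuous_cvg ut; exact: (inv_continuous cfg t0).
by apply: continuous_cvg vs; exact: (inv_continuous cfg s0).
Qed.

(** The bounds come in a forced order: q and w from above by positivity, then w from below, then p
    from above through g p = 2 g q - g w, then q from below, and finally p from below. *)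
Lemma balanced_bounded : D (2 * g t - g s) ->
  exists2 delta, 0 < delta & \forall n \near \oo, forall p q w, balanced n p q w ->
    [/\ delta <= p <= delta^-1, delta <= q <= delta^-1 & delta <= w <= delta^-1].
Proof.
move=> Db.
(* Openness of [D] leaves room above the limit; [df c] becomes the eventual upper bound for p. *)
have [c bc Dc] : exists2 c, 2 * g t - g s < c & D c.
  have nD : \forall x \near (2 * g t - g s), D x.
    by apply: open_nbhs_nbhs; split => //; case: cfg.
  near ((2 * g t - g s)^'+) => c; exists c => //.
  near: c; exact: cvg_within nD.
(* A lower bound for g p once q >= t / 2 and w <= 2 s; the minimum with [g 1] keeps it in [D]. *)
pose lo := Num.min (2 * g (t / 2) - g (2 * s)) (g 1).
have Dlo : D lo.
  apply: (cumulant_down cfg (_ : lo <= g 1)); first by rewrite ge_min lexx orbT.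
  exact: cumulant_inv_dom cfg _ ltr01.
pose m := Num.min (df lo) (Num.min (t / 2) (s / 2)).
pose M := Num.max (df c) (Num.max (2 * t) (2 * s)).
have m0 : 0 < m by rewrite !lt_min (cumulant_gt0 cfg Dlo)/= !divr_gt0.
have M0 : 0 < M by rewrite lt_max (cumulant_gt0 cfg Dc).
exists (Num.min m M^-1); first by rewrite lt_min m0 invr_gt0.
have bnd x : m <= x <= M -> Num.min m M^-1 <= x <= (Num.min m M^-1)^-1.
  move=> /andP[mx xM]; rewrite ge_min mx/= (le_trans xM)//.
  rewrite -[leLHS]invrK lef_pV2 ?posrE ?invr_gt0//.
    by rewrite ge_min lexx orbT.
  by rewrite lt_min m0 invr_gt0.
pose T n := la n * t_ n; pose S n := la n * s_ n.
have cT : T @ \oo --> t by exact: cvg_la.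
have cS : S @ \oo --> s by exact: cvg_la.
have cW : (fun n => la n * s_ n - ka n * T n) @ \oo --> s by exact: cvg_laka cT.
have cQ : (fun n => la n * t_ n - ka n * df c) @ \oo --> t.
  by apply: cvg_laka => //; exact: cvg_cst.
have half_double (x : R) : 0 < x -> x / 2 < x /\ x < 2 * x.
  by move=> x0; split; lra.
have [s2 ss] := half_double _ s0; have [t2 tt] := half_double _ t0.
near=> n => p q w [[p0 q0 w0] [qE wE e]].
have kn := ka_ge0 n.
have qT : q <= T n by rewrite qE gerBl mulr_ge0// ltW.
have wS : w <= S n by rewrite wE gerBl mulr_ge0// ltW.
have wlo : la n * s_ n - ka n * T n <= w by rewrite wE lerB// ler_wpM2l.
have hs2 : s / 2 <= la n * s_ n - ka n * T n.
  by near: n; apply: (cvgr_ge _ cW).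
have s20 : 0 < la n * s_ n - ka n * T n by apply: lt_le_trans hs2; rewrite divr_gt0.
have gpc : g p <= c.
  have : 2 * g (T n) - g (la n * s_ n - ka n * T n) <= c.
    by near: n; apply: (cvgr_le _ (cvg_potential cT cW)).
  by have := inv_le cfg q0 qT; have := inv_le cfg s20 wlo; lra.
have pc : p <= df c by exact: (le_inv cfg).
have qlo : la n * t_ n - ka n * df c <= q by rewrite qE lerB// ler_wpM2l.
have qt2 : t / 2 <= q.
  apply: le_trans qlo; near: n; exact: (cvgr_ge _ cQ).
have T2 : T n <= 2 * t by near: n; apply: (cvgr_le _ cT).
have S2 : S n <= 2 * s by near: n; apply: (cvgr_le _ cS).
have w2 := le_trans hs2 wlo; have q2 := le_trans qT T2; have w2' := le_trans wS S2.
have plo : df lo <= p.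
  apply: (ge_inv cfg) => //; rewrite ge_min; apply/orP; left.
  have := inv_le cfg (divr_gt0 t0 (ltr0Sn _ 1)) qt2.
  by have := inv_le cfg w0 w2'; lra.
split; apply: bnd; apply/andP; split;
  rewrite /m /M ?ge_min ?le_max ?plo ?pc ?qt2 ?q2 ?w2 ?w2' ?orbT//.
Unshelve. all: by end_near. Qed.

(** If p <= C for a large n, then q is at least a quantity tending to t, so c <= g p; as g p lies in
    the down-set [D], so would c. *)
Lemma balanced_unbounded (c : R) : c < 2 * g t - g s -> ~ D c ->
  forall C, \forall n \near \oo, forall p q w, balanced n p q w -> C < p.
Proof.
move=> cb nDc C.
have cQ : (fun n => la n * t_ n - ka n * C) @ \oo --> t.
  by apply: cvg_laka => //; exact: cvg_cst.
have cS : (fun n => la n * s_ n) @ \oo --> s by exact: cvg_la.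
near=> n => p q w [[p0 q0 w0] [qE wE e]]; rewrite ltNge; apply/negP => pC.
have kn := ka_ge0 n.
have Q0 : 0 < la n * t_ n - ka n * C by near: n; exact: (cvgr_gt _ cQ).
have qlo : la n * t_ n - ka n * C <= q by rewrite qE lerB// ler_wpM2l.
have wS : w <= la n * s_ n by rewrite wE gerBl mulr_ge0// ltW.
have : c <= 2 * g (la n * t_ n - ka n * C) - g (la n * s_ n).
  by near: n; apply: (cvgr_ge _ (cvg_potential cQ cS)).
have := inv_le cfg Q0 qlo; have := inv_le cfg w0 wS => h1 h2 h3.
apply: nDc; apply: (cumulant_down cfg (_ : c <= g p)); last first.
  exact: (cumulant_inv_dom cfg).
by lra.
Unshelve. all: by end_near. Qed.

End Asymptotics.

(** * Block proportions for the block size floor(n^rho) *)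

Section Ratios.
Context {R : realType} (rho : R).
Hypothesis rho_itv : 0 <= rho < 1.

Definition block_size (n : nat) : nat := Num.truncn (n%:R `^ rho).

Let k := block_size.

Lemma block_size_bounds (n : nat) : (0 < n)%N -> (0 < k n <= n)%N.
Proof.
move=> n0; have [rho0 rho1] := andP rho_itv.
have n1 : 1 <= n%:R :> R by rewrite ler1n.
rewrite truncn_gt0 -[X in X <= _](powRr0 n%:R) ler_powR//=.
rewrite -(@ler_nat R) (@le_trans _ _ (n%:R `^ rho))//.
  by rewrite truncn_le powR_ge0.
by rewrite -[leRHS]powRr1// ler_powR// ltW.
Qed.

(** Squeeze: k / n <= n^rho / n = (1 / n)^(1 - rho), with positive exponent. The index is shifted to
    n + 1 to keep the denominator nonzero. *)
Lemma cvg_block_density : (fun n => (k n)%:R / n%:R : R) @ \oo --> (0 : R).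
Proof.
have [rho0 rho1] := andP rho_itv.
have h : (fun n => (n.+1%:R^-1 : R) `^ (1 - rho)) @ \oo --> (0 : R).
  have /cvg_at_rightP := @powR_cvg0 R (1 - rho) (ltac:(by rewrite subr_gt0)).
  apply; split; first by move=> n; rewrite invr_gt0 ltr0n.
  exact: cvg_harmonic.
rewrite -cvg_shiftS; apply: (squeeze_cvgr _ (cvg_cst 0) h); near=> n.
rewrite divr_ge0//=; have n0 : 0 < n.+1%:R :> R by rewrite ltr0n.
rewrite ler_pdivrMr//; set x : R := n.+1%:R.
suff -> : x^-1 `^ (1 - rho) * x = x `^ rho by rewrite truncn_le powR_ge0.
rewrite -powR_inv1 ?ler0n// -powRrM -[X in _ * X]powRr1 ?ler0n// -powRD.
  by congr powR; lra.
by apply/implyP => _; rewrite (gt_eqF n0).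
Unshelve. all: by end_near. Qed.

Definition total_ratio (n : nat) : R := n%:R / (n - k n)%:R.
Definition block_ratio (n : nat) : R := (k n)%:R / (n - k n)%:R.

Lemma near_block_size_lt : \forall n \near \oo, (0 < n)%N /\ (k n < n)%N.
Proof.
near=> n; have n0 : (0 < n)%N by near: n; exact: nbhs_infty_gt.
split=> //; have : (k n)%:R / n%:R < 1 :> R.
  by near: n; apply: (cvgr_lt _ cvg_block_density); exact: ltr01.
by rewrite ltr_pdivrMr ?ltr0n// mul1r ltr_nat.
Unshelve. all: by end_near. Qed.

Lemma cvg_total_ratio : total_ratio @ \oo --> (1 : R).
Proof.
have h : (fun n => (1 - (k n)%:R / n%:R : R)^-1) @ \oo --> (1 : R).
  rewrite -[X in _ --> X]invr1; apply: cvgV; first exact: oner_neq0.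
  rewrite -[X in _ --> X]subr0; apply: cvgB; first exact: cvg_cst.
  exact: cvg_block_density.
apply: cvg_trans h; apply: near_eq_cvg; near=> n.
have [n0 /ltnW kn] : (0 < n)%N /\ (k n < n)%N by near: n; exact: near_block_size_lt.
by rewrite /total_ratio natrB// -(invf_div (_ - _)) mulrBl divff// pnatr_eq0 -lt0n.
Unshelve. all: by end_near. Qed.

Lemma cvg_block_ratio : block_ratio @ \oo --> (0 : R).
Proof.
have h : (fun n => (k n)%:R / n%:R * total_ratio n : R) @ \oo --> (0 : R).
  rewrite -(mul0r 1); apply: cvgM; first exact: cvg_block_density.
  exact: cvg_total_ratio.
apply: cvg_trans h; apply: near_eq_cvg; near=> n.
have [n0 _] : (0 < n)%N /\ (k n < n)%N by near: n; exact: near_block_size_lt.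
by rewrite /total_ratio mulrA divfK// pnatr_eq0 -lt0n.
Unshelve. all: by end_near. Qed.

Lemma block_ratio_ge0 (n : nat) : 0 <= block_ratio n.
Proof. by rewrite divr_ge0. Qed.

Lemma balanced_rows (g : R -> R) (s_ t_ : nat -> R) (n : nat) (p q w : R) :
  (k n < n)%N -> [/\ 0 < p, 0 < q & 0 < w] -> g p + g w = 2 * g q ->
  (k n)%:R * p + (n - k n)%:R * q = t_ n * n%:R ->
  (k n)%:R * q + (n - k n)%:R * w = s_ n * n%:R ->
  balanced g total_ratio block_ratio s_ t_ n p q w.
Proof.
move=> kn pos bal rt rs; split=> //.
have l0 : (n - k n)%:R != 0 :> R by rewrite pnatr_eq0 subn_eq0 -ltnNge.
have solve x y (z : R) : (k n)%:R * x + (n - k n)%:R * y = z * n%:R ->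
    y = total_ratio n * z - block_ratio n * x.
  move=> e; rewrite /total_ratio /block_ratio.
  have -> : y = (z * n%:R - (k n)%:R * x) / (n - k n)%:R.
    by rewrite -e addrAC subrr add0r mulrC mulKf.
  by field.
by split=> //; exact: solve.
Qed.

End Ratios.

Lemma sum_two_valued {R : realType} (n k : nat) (x y : R) : (k <= n)%N ->
  \sum_(j < n) (if (j < k)%N then x else y) = k%:R * x + (n - k)%:R * y.
Proof.
move=> kn; have [m ->] : exists m, n = (k + m)%N.
  by exists (n - k)%N; rewrite subnKC.
rewrite addKn big_split_ord/=; congr (_ + _).
  under eq_bigr do rewrite ltn_ord.
  by rewrite sumr_const card_ord mulr_natl.
under eq_bigr do rewrite ltnNge leq_addr/=.
by rewrite sumr_const card_ord mulr_natl.
Qed.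

(** * Tables with prescribed margins *)

Section Margins.
Context {R : realType} (mu : borel_measure R).
Hypotheses (hmu : standing mu) (hA : infsupp mu = 0%E) (hB : supsupp mu = +oo%E).

Lemma domP (x : R) : interior (Theta mu) x <-> (x%:E < phiB mu)%E.
Proof. by apply: interior_ThetaP; rewrite hA. Qed.

Lemma ABP (x : R) : AB mu x <-> 0 < x.
Proof. by rewrite /AB/= hA hB ltry andbT lte_fin. Qed.

(* [derive1] takes the value 0 where the difference quotients diverge, so a
   nonzero value forces differentiability. *)
Lemma derive1_neq0_derivable (f : R -> R) (x : R) :
  derive1 f x != 0 -> derivable f x 1.
Proof.
move=> f0; apply: contrapT => /dvgP fx; move: f0.
by rewrite derive1E /derive fx eqxx.
Qed.

(** Differentiability of [psi] and of [dpsi] is read off from positive values of [derive1]: psi'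
    takes values in (A, B) = (0, +oo), and psi'' > 0 by assumption. *)
Lemma cumulant_standing :
  cumulant (interior (Theta mu)) (psi mu) (dpsi mu) (phi mu).
Proof.
have [_ _ cvx [dfun dinj dsurj]] := hmu.
have gt0 x : interior (Theta mu) x -> 0 < dpsi mu x by move=> /dfun/ABP.
have phidpsi x : interior (Theta mu) x -> phi mu (dpsi mu x) = x.
  by move=> Dx; rewrite /phi pinvKV// inE.
split.
- exact: open_interior.
- by move=> x y xy; rewrite !domP; apply: le_lt_trans; rewrite lee_fin.
- move=> x /gt0; rewrite lt0r => /andP[/derive1_neq0_derivable dx _].
  by apply: DeriveDef; [exact: dx|rewrite -derive1E].
- by move=> x /cvx; rewrite lt0r => /andP[/derive1_neq0_derivable].
- exact: cvx.
- exact: gt0.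
- by move=> z /ABP /dsurj[x Dx <-]; rewrite phidpsi.
- by move=> z /ABP /dsurj[x Dx <-]; rewrite phidpsi.
- exact: phidpsi.
Qed.

(** Any table with the given margins turns the likelihood into a sum over entries, to which the
    tangent inequality applies term by term. *)
Lemma log_likelihoodE (m n : nat) (r : 'rV[R]_m) (c : 'rV[R]_n)
    (W : 'M[R]_(m, n)) (a : 'rV[R]_m) (b : 'rV[R]_n) :
  (forall i, \sum_j W i j = r 0 i) -> (forall j, \sum_i W i j = c 0 j) ->
  log_likelihood mu r c a b =
  \sum_i \sum_j (W i j * (a 0 i + b 0 j) - psi mu (a 0 i + b 0 j)).
Proof.
move=> rW cW; rewrite /log_likelihood.
under [in RHS]eq_bigr do rewrite big_split/= sumrN.
rewrite [RHS]big_split/= sumrN; congr (_ - _).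
under [in RHS]eq_bigr do under eq_bigr do rewrite mulrDr.
under [in RHS]eq_bigr do rewrite big_split/=.
rewrite [RHS]big_split/=; congr (_ + _).
  by apply: eq_bigr => i _; rewrite -mulr_suml rW.
by rewrite exchange_big/=; apply: eq_bigr => j _; rewrite -mulr_suml cW.
Qed.

Section FirstOrder.
Context {m n : nat} (r : 'rV[R]_m) (c : 'rV[R]_n) (a : 'rV[R]_m) (b : 'rV[R]_n).
Let Z := \matrix_(i, j) dpsi mu (a 0 i + b 0 j).
Hypotheses (adm : mle_admissible mu a b).
Hypotheses (rZ : forall i, \sum_j Z i j = r 0 i).
Hypotheses (cZ : forall j, \sum_i Z i j = c 0 j).

Let cfg := cumulant_standing.

Lemma is_mle_first_order : is_mle mu r c a b.
Proof.
split; first exact: adm.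
move=> a' b' adm'; rewrite !(log_likelihoodE _ _ rZ cZ).
apply: ler_sum => i _; apply: ler_sum => j _; rewrite mxE.
exact: (tangent_le cfg).
Qed.

Lemma typical_table_first_order : is_typical_table mu r c Z.
Proof.
have Z0 i j : 0 < Z i j by rewrite mxE; exact: (cumulant_gt0 cfg).
have ZP : transport_polytope mu r c Z by split=> // i j; exact/ABP.
(* The Fenchel-Young gap of an entry. The gaps are nonnegative, sum to cost minus likelihood, and
   vanish on [Z]; this is weak duality with equality at [Z]. *)
pose e (W : 'M[R]_(m, n)) i j := W i j * phi mu (W i j) - psi mu (phi mu (W i j)) -
  (W i j * (a 0 i + b 0 j) - psi mu (a 0 i + b 0 j)).
have eE W : transport_polytope mu r c W ->
    table_cost mu W - log_likelihood mu r c a b = \sum_i \sum_j e W i j.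
  move=> [_ rW cW]; rewrite (log_likelihoodE _ _ rW cW) -sumrB.
  by apply: eq_bigr => i _; rewrite -sumrB.
have e0 W i j : transport_polytope mu r c W -> 0 <= e W i j.
  case=> /(_ i j)/ABP W0 _ _; rewrite subr_ge0 -{1 2}(cumulant_invK cfg W0).
  by apply: (tangent_le cfg (cumulant_inv_dom cfg W0) (adm i j)).
have cZE : table_cost mu Z = log_likelihood mu r c a b.
  apply/eqP; rewrite -subr_eq0 eE// big1// => i _; rewrite big1// => j _.
  by rewrite /e mxE (cumulant_derivK cfg)// subrr.
split.
  split; [exact: ZP|move=> W PW].
  rewrite cZE -subr_ge0 eE// sumr_ge0// => i _.
  by rewrite sumr_ge0// => j _; exact: e0.
move=> W [PW minW].
(* Another minimizer also has total gap 0, so every gap vanishes, and strictness forces phi(W_ij) =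
   a_i + b_j. *)
have : \sum_i \sum_j e W i j = 0.
  apply/eqP; rewrite eq_le -eE// subr_le0 -cZE minW//= cZE eE// sumr_ge0// => i _.
  by rewrite sumr_ge0// => j _; exact: e0.
move=> /psumr_eq0P eW; apply/matrixP => i j.
have /psumr_eq0P eWi := eW (fun i _ => sumr_ge0 _ (fun j _ => e0 W i j PW)) i isT.
have eWij := eWi (fun j _ => e0 W i j PW) j isT.
have /ABP W0 : AB mu (W i j) by case: PW.
have [phiW|neq] := eqVneq (phi mu (W i j)) (a 0 i + b 0 j).
  by rewrite mxE -phiW (cumulant_invK cfg).
have := tangent_lt cfg (cumulant_inv_dom cfg W0) (adm i j) neq.
rewrite (cumulant_invK cfg W0) -subr_gt0 => h.
by move: eWij h; rewrite /e => ->; rewrite ltxx.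
Qed.

End FirstOrder.

(** * The explicit table of a two-valued margin *)

Section TwoValues.
Context (rho : R) (s_ t_ : nat -> R).
Hypotheses (rho_itv : 0 <= rho < 1).
Hypotheses (hs : forall n, (0 < n)%N -> 0 < s_ n).
Hypotheses (ht : forall n, (0 < n)%N -> 0 < t_ n).

Let k := block_size rho.

Definition two_valued_table (n : nat) (p q w : R) : 'M[R]_n :=
  \matrix_(i, j) if (i < k n)%N then (if (j < k n)%N then p else q)
                 else (if (j < k n)%N then q else w).

Lemma two_valued_solution (n : nat) : (0 < n)%N ->
  let r := two_value_margin rho s_ t_ n in
  exists p q w, [/\ [/\ 0 < p, 0 < q & 0 < w],
    (k n < n)%N ->
      balanced (phi mu) (total_ratio rho) (block_ratio rho) s_ t_ n p q w,
    is_typical_table mu r r (two_valued_table n p q w) &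
    exists a, is_mle mu r r a a /\
      forall i j, dpsi mu (a 0 i + a 0 j) = two_valued_table n p q w i j].
Proof.
move=> n0 r; have /andP[k0 kn] := block_size_bounds rho_itv n0.
have cfg := cumulant_standing.
have nR : 0 < n%:R :> R by rewrite ltr0n.
have kR : 0 < (k n)%:R :> R by rewrite ltr0n.
have [p [q [w [pos rowt rows bal]]]] : exists p q w : R, [/\
    [/\ 0 < p, 0 < q & 0 < w],
    (k n)%:R * p + (n - k n)%:R * q = t_ n * n%:R,
    (k n < n)%N -> (k n)%:R * q + (n - k n)%:R * w = s_ n * n%:R &
    phi mu p + phi mu w = 2 * phi mu q].
  have T0 : 0 < t_ n * n%:R by rewrite mulr_gt0 ?ht.
  have S0 : 0 < s_ n * n%:R by rewrite mulr_gt0 ?hs.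
  have [kltn|] := ltnP (k n) n.
    have l0 : 0 < (n - k n)%:R :> R by rewrite ltr0n subn_gt0.
    have [p [q [w [pos [e1 e2 e3]]]]] := balanced_values cfg kR l0 T0 S0.
    by exists p, q, w.
  (* Here the small block is empty, as happens for n = 1; the constant table t_n works. *)
  move=> nk; have kE : k n = n by apply/eqP; rewrite eqn_leq kn.
  have t0 := ht n0; exists (t_ n), (t_ n), (t_ n); split=> //.
    by rewrite kE subnn mul0r addr0 mulrC.
  by rewrite mulr_natl mulr2n.
have [p0 q0 w0] := pos.
(* Halving is right on the diagonal blocks, and phi(p) + phi(w) = 2 phi(q) makes it right on the
   mixed ones. *)
pose x (z : R) := phi mu z / 2.
pose a : 'rV[R]_n := \row_i if (i < k n)%N then x p else x w.
have xx z : x z + x z = phi mu z by rewrite -splitr.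
have xpw : x p + x w = phi mu q by rewrite /x; lra.
have aE i j : a 0 i + a 0 j = phi mu (two_valued_table n p q w i j).
  by rewrite !mxE; case: ifP => _; case: ifP => _; rewrite // addrC.
have tab0 i j : 0 < two_valued_table n p q w i j.
  by rewrite mxE; case: ifP => _; case: ifP.
have dE i j : dpsi mu (a 0 i + a 0 j) = two_valued_table n p q w i j.
  by rewrite aE (cumulant_invK cfg).
have adm : mle_admissible mu a a.
  by move=> i j; rewrite aE; exact: (cumulant_inv_dom cfg).
pose Z : 'M[R]_n := \matrix_(i, j) dpsi mu (a 0 i + a 0 j).
have ZE : Z = two_valued_table n p q w by apply/matrixP => i j; rewrite mxE dE.
have rZ i : \sum_j Z i j = r 0 i.
  rewrite ZE [RHS]mxE.
  under eq_bigr do rewrite mxE.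
  have [ik|ki] := ifPn; first by rewrite sum_two_valued// rowt.
  rewrite sum_two_valued// rows//.
  by apply: leq_ltn_trans (ltn_ord i); rewrite leqNgt.
have cZ j : \sum_i Z i j = r 0 j.
  by rewrite -rZ; apply: eq_bigr => i _; rewrite !mxE addrC.
exists p, q, w; split; first exact: pos.
    by move=> kltn; apply: balanced_rows => //; exact: rows.
  by rewrite -ZE; exact: typical_table_first_order.
by exists a; split; [exact: is_mle_first_order|exact: dE].
Qed.

End TwoValues.

End Margins.

(** * Uniform tameness and the two regimes *)

Lemma tameS {R : realType} (mu : borel_measure R) (m n : nat) (r : 'rV[R]_m)
    (c : 'rV[R]_n) (d d' : R) :
  0 < d' -> d' <= d -> tame mu r c d -> tame mu r c d'.
Proof.
move=> d'0 d'd [a [b [ab h]]]; exists a, b; split; first exact: ab.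
move=> i j; have d0 := lt_le_trans d'0 d'd.
have dV : d^-1 <= d'^-1 by rewrite lef_pV2.
have /andP[lo hi] := h i j; apply/andP; split.
  apply: le_trans lo; rewrite /Adelta ge_max !le_max leeD2l ?lee_fin//.
  by rewrite lerN2 dV orbT.
apply: le_trans hi _; rewrite /Bdelta le_min !ge_min leeB ?lee_fin//.
by rewrite dV orbT.
Qed.

(** The tail has one common constant, and only finitely many indices remain, so a finite minimum
    works. *)
Lemma eventually_uniform {R : realType} (P : nat -> R -> Prop) :
  (forall n (d d' : R), 0 < d' -> d' <= d -> P n d -> P n d') ->
  (forall n, exists2 d, 0 < d & P n d) ->
  (exists2 d, 0 < d & \forall n \near \oo, P n d) ->
  exists2 d, 0 < d & forall n, P n d.
Proof.
move=> PS Pn [d d0 [N _ hN]].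
have [e e0 he] : exists2 e, 0 < e & forall n, (n < N)%N -> P n e.
  elim: N {hN} => [|N [e e0 he]]; first by exists 1.
  have [e' e'0 he'] := Pn N; have m0 : 0 < Num.min e e' by rewrite lt_min e0.
  exists (Num.min e e') => // n; rewrite ltnS leq_eqVlt => /predU1P[->|nN].
    by apply: PS he' => //; rewrite ge_min lexx orbT.
  by apply: PS (he _ nN) => //; rewrite ge_min lexx.
have m0 : 0 < Num.min d e by rewrite lt_min d0.
exists (Num.min d e) => // n; have [nN|Nn] := ltnP n N.
  by apply: PS (he _ nN) => //; rewrite ge_min lexx orbT.
by apply: PS (hN _ Nn) => //; rewrite ge_min lexx.
Qed.

(** For A = 0 and B = +oo, the bounds A_d and B_d are just d and 1 / d. *)
Lemma tame_two_valued {R : realType} (mu : borel_measure R) (rho : R) (n : nat)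
    (r : 'rV[R]_n) (d p q w : R) :
  infsupp mu = 0%E -> supsupp mu = +oo%E -> 0 < d ->
  [/\ d <= p <= d^-1, d <= q <= d^-1 & d <= w <= d^-1] ->
  (exists a, is_mle mu r r a a /\
     forall i j, dpsi mu (a 0 i + a 0 j) = two_valued_table rho n p q w i j) ->
  tame mu r r d.
Proof.
move=> hA hB d0 [pd qd wd] [a [mle aE]]; exists a, a; split; first exact: mle.
move=> i j; rewrite aE /Adelta /Bdelta hA hB add0e addye// minye -EFin_max !lee_fin.
have -> : Num.max d (- d^-1) = d.
  by apply/max_idPl; rewrite (le_trans _ (ltW d0))// oppr_le0 invr_ge0 ltW.
by rewrite mxE; case: ifP => _; case: ifP => _;
  [exact: pd|exact: qd|exact: qd|exact: wd].
Qed.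

Lemma two_sided_bound {R : realType} (p q w : R) : 0 < p -> 0 < q -> 0 < w ->
  exists2 d, 0 < d &
    [/\ d <= p <= d^-1, d <= q <= d^-1 & d <= w <= d^-1].
Proof.
move=> p0 q0 w0.
have [lo lo0 bnd] : exists2 lo : R -> R, forall x, 0 < x -> 0 < lo x &
    forall d x, 0 < d -> 0 < x -> d <= lo x -> d <= x <= d^-1.
  exists (fun x => Num.min x x^-1) => [x x0|d x d1 x0].
    by rewrite lt_min x0 invr_gt0.
  by rewrite le_min => /andP[-> /=]; rewrite -lef_pV2 ?invrK// posrE invr_gt0.
have d0 : 0 < Num.min (lo p) (Num.min (lo q) (lo w)) by rewrite !lt_min !lo0.
exists (Num.min (lo p) (Num.min (lo q) (lo w))) => //.
by split; apply: bnd => //; rewrite !ge_min lexx ?orbT.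
Qed.

Theorem corollary1p21 (R : realType) (mu : borel_measure R)
  (hmu : standing mu)
  (hA : infsupp mu = 0%E) (hB : supsupp mu = +oo%E)
  (rho : R) (hrho : 0 <= rho < 1)
  (s_ t_ : nat -> R)
  (hs_ : forall n, (0 < n)%N -> 0 < s_ n)
  (ht_ : forall n, (0 < n)%N -> 0 < t_ n)
  (s t : R) (hs : s_ @ \oo --> s) (ht : t_ @ \oo --> t)
  (s_gt0 : 0 < s) (s_le_t : s <= t) :
  (((2 * phi mu t - phi mu s)%:E < phiB mu)%E ->
     exists2 delta : R, 0 < delta &
       forall n : nat, (0 < n)%N ->
         tame mu (two_value_margin rho s_ t_ n)
                 (two_value_margin rho s_ t_ n) delta) /\
  ((phiB mu < (2 * phi mu t - phi mu s)%:E)%E ->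
     exists2 Z : forall n : nat, 'M[R]_n.+1,
       forall n : nat, is_typical_table mu (two_value_margin rho s_ t_ n.+1)
                         (two_value_margin rho s_ t_ n.+1) (Z n) &
       Z n ord0 ord0 @[n --> \oo] --> +oo).
Proof.
have cfg := cumulant_standing hmu hA hB.
have t_gt0 := lt_le_trans s_gt0 s_le_t.
have la1 := cvg_total_ratio hrho; have ka0 := cvg_block_ratio hrho.
have ka_ge0 := @block_ratio_ge0 R rho.
have sol n := @two_valued_solution _ _ hmu hA hB _ _ _ hrho hs_ ht_ n.
split=> [|phiBlt].
  rewrite -(domP hA) => Db.
  pose r n : 'rV[R]_n := two_value_margin rho s_ t_ n.
  pose P n d := (0 < n)%N -> tame mu (r n) (r n) d.
  apply: (@eventually_uniform _ P).
  - by move=> n d d' d'0 d'd h n0; apply: tameS (h n0).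
  - move=> n; case: (posnP n) => [->|n0]; first by exists 1.
    have [p [q [w [[p0 q0 w0] _ _ mle]]]] := sol n n0.
    have [d d0 bnd] := two_sided_bound p0 q0 w0; exists d => // _.
    exact: tame_two_valued bnd mle.
  - have [d d0 hd] := balanced_bounded cfg la1 ka0 ka_ge0 hs ht s_gt0 t_gt0 Db.
    exists d => //; near=> n => n0.
    have [p [q [w [_ bal _ mle]]]] := sol n n0.
    apply: tame_two_valued mle => //.
    have [_ kltn] : (0 < n)%N /\ (block_size rho n < n)%N.
      by near: n; exact: near_block_size_lt.
    by move: (bal kltn); move: p q w {bal}; near: n.
(* c is phi(B) itself: it is not +oo by the strict inequality, nor -oo because [phi mu 1] lies below
   it. *)
have [c cb nDc] : exists2 c, c < 2 * phi mu t - phi mu s & ~ interior (Theta mu) c.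
  move: phiBlt; case E : (phiB mu) => [c||] //.
    by rewrite lte_fin => cb; exists c => //; rewrite (domP hA) E ltxx.
  by move=> _; have := cumulant_inv_dom cfg ltr01; rewrite (domP hA) E.
have unb := balanced_unbounded cfg la1 ka0 ka_ge0 hs ht s_gt0 t_gt0 cb nDc.
pose typ n (Z : 'M[R]_n.+1) := is_typical_table mu (two_value_margin rho s_ t_ n.+1)
  (two_value_margin rho s_ t_ n.+1) Z.
pose bal := balanced (phi mu) (total_ratio rho) (block_ratio rho) s_ t_.
(* Choosing the table together with its balanced triple ties the corner entry to p; the corner lies
   in the large block because k >= 1. *)
pose good n (Z : 'M[R]_n.+1) := typ n Z /\ ((block_size rho n.+1 < n.+1)%N ->
  exists q w, bal n.+1 (Z ord0 ord0) q w).
have Zex n : exists Z, good n Z.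
  have [p [q [w [_ pqw tt _]]]] := sol n.+1 isT.
  exists (two_valued_table rho n.+1 p q w); split; first exact: tt.
  move=> kn; exists q, w; rewrite mxE/=.
  by have /andP[-> _] := block_size_bounds hrho (ltn0Sn n); exact: pqw.
exists (fun n => xget 0 (good n)).
  by move=> n; have [] := xgetPex 0 (Zex n).
apply/cvgryPge => C; near=> n.
have [_ /(_ _)] := xgetPex 0 (Zex n).
have [_ kltn] : (0 < n.+1)%N /\ (block_size rho n.+1 < n.+1)%N.
  by near: n; exact: (cvg_addnl 1 _ (near_block_size_lt hrho)).
move=> /(_ kltn)[q [w pqw]]; apply/ltW.
(* The table of index n has size n + 1, hence the shift of the eventual bound. *)
have : forall p q w, bal n.+1 p q w -> C < p.
  by near: n; exact: (cvg_addnl 1 _ (unb C)).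
by move/(_ _ _ _ pqw).
Unshelve. all: by end_near. Qed.
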